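(* Let $R$ be a Noetherian local ring, and let $I\subsetneq R$ be a proper ideal. If $\mathrm{grade}\, I\geq 2$ and $\mathrm{Fitt}_1(I)=I$, then $I$ is a perfect ideal of grade $2$.
   Context: For a finitely generated module $M$ over a Noetherian ring $R$, choose a finite free presentation $G\to F\to M\to 0$ with $\mathrm{rank}\,F=r$, and let $A$ be a matrix representing $G\to F$. The $j$th Fitting ideal of $M$ is $\mathrm{Fitt}_j(M)=I_{r-j}(A)$, where $I_t(A)$ is the ideal generated by the $t$-minors of $A$, with $I_t(A)=R$ for $t\le 0$. This is independent of the choices. An ideal $I$ is regarded as an $R$-module. $\mathrm{grade}\,I$ is the length of a maximal $R$-regular sequence contained in $I$. The ideal $I$ is perfect of grade $2$ if $\mathrm{grade}\,I=2$ and the projective dimension of $R/I$ equals $2$. *)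

(* Defs.v *)
From HB Require Import structures.
From mathcomp Require Import all_boot all_algebra.
From mathcomp Require Import boolp classical_sets.

Set Implicit Arguments.
Unset Strict Implicit.
Unset Printing Implicit Defensive.

Import GRing.Theory.
Local Open Scope classical_set_scope.
Local Open Scope ring_scope.
Local Open Scope quotient_scope.

(* Proper ideals are elements of MathComp's [idealr R], that is, boolean
   predicates; with the classical axioms of [boolp] every proper ideal is of
   this form.  Ideals that are generated by elements, and so may be the unit
   ideal, are classical sets. *)

Section IdealModules.
Context (R : comNzRingType) (I : idealr R).

Definition ideal_module : Type := {x : R | x \in (I : {pred R})}.

HB.instance Definition _ := SubChoice.on ideal_module.
HB.instance Definition _ := [SubChoice_isSubZmodule of ideal_module by <:].

Fact ideal_module_subproof (a : R) (x : ideal_module) :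
  a * val x \in (I : {pred R}).
Proof. exact/idealMr/valP. Qed.

Definition ideal_module_scale (a : R) (x : ideal_module) : ideal_module :=
  Sub (a * val x) (ideal_module_subproof a x).

Fact ideal_module_scalerA a b v :
  ideal_module_scale a (ideal_module_scale b v) = ideal_module_scale (a * b) v.
Proof. by apply/val_inj; rewrite !SubK mulrA. Qed.
Fact ideal_module_scale1r : left_id 1 ideal_module_scale.
Proof. by move=> v; apply/val_inj; rewrite SubK mul1r. Qed.
Fact ideal_module_scalerDr : right_distributive ideal_module_scale +%R.
Proof. by move=> a u v; apply/val_inj; rewrite SubK !raddfD /= mulrDr. Qed.
Fact ideal_module_scalerDl v : {morph ideal_module_scale^~ v : a b / a + b}.
Proof. by move=> a b; apply/val_inj; rewrite SubK raddfD /= mulrDl. Qed.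

HB.instance Definition _ := GRing.Zmodule_isLmodule.Build R ideal_module
  ideal_module_scalerA ideal_module_scale1r
  ideal_module_scalerDr ideal_module_scalerDl.

Definition ideal_quot_scale (a : R) (x : {ideal_quot I}) : {ideal_quot I} :=
  \pi a * x.

Fact ideal_quot_scalerA a b v :
  ideal_quot_scale a (ideal_quot_scale b v) = ideal_quot_scale (a * b) v.
Proof. by rewrite /ideal_quot_scale rmorphM mulrA. Qed.
Fact ideal_quot_scale1r : left_id 1 ideal_quot_scale.
Proof. by move=> v; rewrite /ideal_quot_scale rmorph1 mul1r. Qed.
Fact ideal_quot_scalerDr : right_distributive ideal_quot_scale +%R.
Proof. by move=> a u v; rewrite /ideal_quot_scale mulrDr. Qed.
Fact ideal_quot_scalerDl v : {morph ideal_quot_scale^~ v : a b / a + b}.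
Proof. by move=> a b; rewrite /ideal_quot_scale rmorphD mulrDl. Qed.

HB.instance Definition _ := GRing.Zmodule_isLmodule.Build R {ideal_quot I}
  ideal_quot_scalerA ideal_quot_scale1r
  ideal_quot_scalerDr ideal_quot_scalerDl.

End IdealModules.

Section Rings.
Context (R : comNzRingType).

Definition ideal_gen (S : set R) : set R :=
  [set x | exists c : seq (R * R),
     (forall p, p \in c -> S p.2) /\ x = \sum_(p <- c) p.1 * p.2].

(* The unit ideal needs no mention: it is generated by 1. *)
Definition noetherian : Prop :=
  forall J : idealr R, exists s : seq R, [set` J] = ideal_gen [set` s].

Definition maximal_ideal (m : idealr R) : Prop :=
  forall J : idealr R, {subset m <= J} -> J =i m.

Definition local_ring : Prop :=
  exists2 m : idealr R, maximal_ideal m &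
    forall m' : idealr R, maximal_ideal m' -> m' =i m.

Definition regular_seq (s : seq R) : Prop :=
  (forall i, (i < size s)%N -> forall a : R,
     ideal_gen [set` take i s] (s`_i * a) -> ideal_gen [set` take i s] a)
  /\ ~ ideal_gen [set` s] 1.

Definition maximal_regular_seq_in (I : idealr R) (s : seq R) : Prop :=
  [/\ regular_seq s, {subset s <= I} &
      forall x, x \in I -> ~ regular_seq (rcons s x)].

(* A relation: over a Noetherian ring all maximal regular sequences in [I]
   have the same length. *)
Definition has_grade (I : idealr R) (n : nat) : Prop :=
  exists2 s, maximal_regular_seq_in I s & size s = n.

Definition minors (t m r : nat) (A : 'M[R]_(m, r)) : set R :=
  [set d | exists (f : 'I_t -> 'I_m) (g : 'I_t -> 'I_r),
     [/\ {homo f : i j / (i < j)%N}, {homo g : i j / (i < j)%N}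
       & d = \det (mxsub f g A)]].

(* Row-vector convention: [A] represents the map u |-> u *m A from G = R^m
   to F = R^r, so its rows are the relations between the generators of [M]. *)
Definition free_presentation (M : lmodType R) (m r : nat)
    (A : 'M[R]_(m, r)) : Prop :=
  exists2 f : {linear 'rV[R]_r -> M},
    forall y, exists v, f v = y &
    forall v, f v = 0 <-> exists u : 'rV[R]_m, v = u *m A.

(* A relation, since the ideal does not depend on the presentation.  The
   subtraction is truncated; as the only 0-minor is 1, this gives the unit
   ideal whenever r <= j. *)
Definition is_Fitting_ideal (j : nat) (M : lmodType R) (J : set R) : Prop :=
  exists (m r : nat) (A : 'M[R]_(m, r)),
    free_presentation M A /\ J = ideal_gen (minors (r - j) A).

Definition projective_module (P : lmodType R) : Prop :=
  forall (M N : lmodType R) (f : {linear M -> N}) (g : {linear P -> N}),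
    (forall y, exists x, f x = y) ->
    exists h : {linear P -> M}, forall x, f (h x) = g x.

Definition proj_dim_le (M : lmodType R) (n : nat) : Prop :=
  exists (P : nat -> lmodType R) (d : forall i, {linear P i.+1 -> P i})
         (e : {linear P 0%N -> M}),
    [/\ forall i, projective_module (P i),
        forall i, (n < i)%N -> forall x : P i, x = 0,
        forall y, exists x, e x = y,
        forall x, e x = 0 <-> exists y, d 0%N y = x
      & forall i (x : P i.+1), d i x = 0 <-> exists y, d i.+1 y = x].

Definition has_proj_dim (M : lmodType R) (n : nat) : Prop :=
  proj_dim_le M n /\ forall k, (k < n)%N -> ~ proj_dim_le M k.

Definition perfect_of_grade2 (I : idealr R) : Prop :=
  has_grade I 2 /\ has_proj_dim {ideal_quot I} 2.

End Rings.

(* Main.v *)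
From HB Require Import structures.
Require Import Defs.
From mathcomp Require Import all_boot all_algebra.
From mathcomp Require Import boolp classical_sets.

Set Implicit Arguments.
Unset Strict Implicit.
Unset Printing Implicit Defensive.

Import GRing.Theory.
Local Open Scope ring_scope.
Local Open Scope quotient_scope.

(** Choose generators x_0, ..., x_n of I and let x be the column that they
    form, so that the relations of I are the rows u with u x = 0.  The
    hypothesis grade I >= 2 enters mainly through one consequence
    ([hom_ideal_mulmx]): every homomorphism from I to a free module is
    multiplication by a fixed row, because I contains a regular pair a, b.

    Take any n rows of the presentation matrix and call the resulting matrix B.
    The signed maximal minors D_i of B satisfy v D = det (v over B), and when v
    is a relation this determinant kills I and so vanishes; hence x_i |-> D_i is
    a well-defined homomorphism from I to R, and D = l x for some l
    ([signed_minors_multiple]).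
    So every n-minor of the presentation lies in l I for a suitable l of this
    kind, and Fitt_1(I) = I says that I = L I, where L is generated by all the
    l.  As I is not 0, Nakayama's lemma forbids that all the l lie in the maximal
    ideal: for some choice of rows l is a unit ([signed_minors_unit_multiple]).

    For that B a converse of the Hilbert-Burch theorem holds: the sequence
    0 -> R^n -> R^(n+1) -> R -> R/I -> 0 given by B and x is exact
    ([hilbert_burch_inj], [hilbert_burch_exact]), so R/I has projective
    dimension at most 2.  It is not at most 1, since then I would be
    projective; a splitting of R^(n+1) -> I is multiplication by a row w, which
    forces w x = 1 and so 1 in I ([not_proj_dim_le_quot1]).  Finally a regular
    sequence a, b, c in I would make Hom(R/I, R/(a, b)) zero, hence also
    Ext^2(R/I, R); [regular_triple_unit] turns this into an explicit derivation
    of 1 in I from the resolution, so a, b is a maximal regular sequence. *)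

(** * Signed maximal minors of an n x (n+1) matrix *)

Section SignedMinors.
Context (R : comNzRingType) (n : nat) (B : 'M[R]_(n, 1 + n)).

(** The cofactors of the first row of [col_mx v B], which do not depend on [v];
    the choice [v = 0] is arbitrary.  Entry [k] is [(-1) ^+ k] times the minor of
    [B] that omits column [k]. *)
Definition signed_minors : 'cV[R]_(1 + n) := lsubmx (\adj (col_mx 0 B)).

Lemma lsubmx_adj_col_mx (v : 'rV[R]_(1 + n)) :
  lsubmx (\adj (col_mx v B)) = signed_minors.
Proof.
apply/matrixP=> i j; rewrite !mxE (ord1 j) /cofactor; congr (_ * \det _).
apply/matrixP=> a b; rewrite !mxE.
by case: splitP => // k; rewrite (ord1 k) /= /bump.
Qed.

(** Laplace expansion along the first row. *)
Lemma mul_signed_minors (v : 'rV[R]_(1 + n)) :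
  v *m signed_minors = (\det (col_mx v B))%:M.
Proof.
rewrite -(lsubmx_adj_col_mx v) mulmx_lsub.
have -> : v *m \adj (col_mx v B) = usubmx ((\det (col_mx v B))%:M : 'M_(1 + n)).
  by rewrite -mul_mx_adj mul_col_mx col_mxKu.
by rewrite scalar_mx_block /block_mx col_mxKu row_mxKl.
Qed.

(** Cramer's rule: the adjugate of [col_mx v B] gives the coefficients.  This is
    what remains, over any commutative ring, of the fact that [v] depends
    linearly on the rows of [B] when the determinant vanishes. *)
Lemma signed_minors_mul (v : 'rV[R]_(1 + n)) : \det (col_mx v B) = 0 ->
  exists W, signed_minors *m v = W *m B.
Proof.
move=> det0; exists (- rsubmx (\adj (col_mx v B))).
have := mul_adj_mx (col_mx v B).
rewrite det0 -{1}(hsubmxK (\adj _)) mul_row_col lsubmx_adj_col_mx => /eqP.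
by rewrite raddf0 addr_eq0 mulNmx => /eqP.
Qed.

(** The row [row_mx 0 u] kills [col_mx v B] for every [v], so the determinant of
    that matrix kills [u]; taking [v] to be a unit row singles out one signed
    minor. *)
Lemma signed_minors_kermx (u : 'rV[R]_n) : u *m B = 0 -> signed_minors *m u = 0.
Proof.
move=> uB0; apply/row_matrixP=> i; rewrite row_mul row0 rowE mul_signed_minors.
set v := delta_mx _ _; rewrite mul_scalar_mx.
have : row_mx 0 u *m col_mx v B *m \adj (col_mx v B) = 0.
  by rewrite mul_row_col uB0 mul0mx addr0 mul0mx.
rewrite -mulmxA mul_mx_adj mul_mx_scalar => /(congr1 rsubmx).
by rewrite scale_row_mx row_mxKr => ->; rewrite raddf0.
Qed.

(** A map from ['I_n] misses some column [k], so it factors through [lift k],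
    and the determinant becomes that of [col' k B] times that of the matrix of
    the remaining self-map of ['I_n]. *)
Lemma det_colsub_signed_minors (g : 'I_n -> 'I_(1 + n)) :
  exists k c, \det (colsub g B) = c * signed_minors k 0.
Proof.
have [k kNg] : exists k, k \notin codom g.
  apply/existsP; apply: contraT; rewrite negb_exists => /forallP gP.
  have /subset_leq_card : 'I_(1 + n) \subset codom g.
    by apply/fintype.subsetP=> k _; move: (gP k); rewrite negbK.
  by move=> /leq_trans/(_ (leq_image_card _ _)); rewrite !card_ord ltnn.
pose h i := odflt i (unlift k (g i)).
have gE i : g i = lift k (h i).
  rewrite /h; case: unliftP => [j -> //|gik].
  by rewrite -gik codom_f in kNg.
exists k, ((-1) ^+ k * \det (colsub h 1%:M)).
have -> : colsub g B = col' k B *m colsub h 1%:M.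
  by rewrite mulmx_colsub mulmx1; apply/matrixP=> i j; rewrite !mxE gE.
rewrite det_mulmx !mxE /cofactor mulrC -mulrA mulrCA; congr (_ * _).
rewrite (_ : (-1) ^+ (lshift n 0 + k) = (-1) ^+ k) //.
rewrite mulrA -expr2 sqrr_sign mul1r; congr (\det _).
apply/matrixP=> a b; rewrite !mxE; case: splitP => [j|j /= ja].
  by rewrite (ord1 j) /= /bump.
by congr (B _ _); apply/val_inj; move: ja; rewrite /bump /= => -[].
Qed.

End SignedMinors.

(** * Homomorphisms from an ideal that contains a regular pair *)

Section RegularPair.
Context (R : comNzRingType).

(** Regular sequences of length 2, without the condition that they generate a
    proper ideal. *)
Definition weakly_regular_pair (a b : R) : Prop :=
  GRing.lreg a /\ forall c d, b * c = a * d -> exists e, c = a * e.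

Lemma lreg_scalemx_inj m n (a : R) (A C : 'M[R]_(m, n)) :
  GRing.lreg a -> a *: A = a *: C -> A = C.
Proof.
move=> ra /matrixP E; apply/matrixP=> i j; apply: ra.
by have := E i j; rewrite !mxE.
Qed.

Lemma weakly_regular_pair_mx m n (a b : R) (C D : 'M[R]_(m, n)) :
  weakly_regular_pair a b -> b *: C = a *: D -> exists E, C = a *: E.
Proof.
move=> [_ rb] /matrixP E.
have e i j : {e | C i j = a * e}.
  by apply/cid/(rb _ (D i j)); have := E i j; rewrite !mxE.
by exists (\matrix_(i, j) sval (e i j)); apply/matrixP=> i j; rewrite !mxE; case: (e i j).
Qed.

Context (n : nat) (x : 'cV[R]_n) (a b : R) (p q : 'rV[R]_n).
Hypotheses (ab : weakly_regular_pair a b).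
Hypotheses (px : p *m x = a%:M) (qx : q *m x = b%:M).

(** The entries of [x] generate an ideal that contains the nonzerodivisor [a]. *)
Lemma regular_col_cancel k (w : 'rV[R]_k) : x *m w = 0 -> w = 0.
Proof.
move=> /(congr1 (mulmx p)); rewrite mulmxA px mul_scalar_mx mulmx0 => aw.
by apply: (lreg_scalemx_inj ab.1); rewrite scaler0.
Qed.

(** Hom(I, R^k) = R^k when I, the ideal of the entries of [x], contains a
    regular pair: the rows of [h] are the images of the generators, and the
    hypothesis says that [h] respects their relations.  The values
    [p *m h] at [a] and [q *m h] at [b] satisfy b h(a) = a h(b), so a divides
    h(a), and the quotient is the required row. *)
Lemma hom_ideal_mulmx k (h : 'M[R]_(n, k)) :
    (forall v : 'rV_n, v *m x = 0 -> v *m h = 0) ->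
  exists w, h = x *m w.
Proof.
move=> xh.
have xhM m (V : 'M_(m, n)) : V *m x = 0 -> V *m h = 0.
  move=> Vx; apply/row_matrixP=> i; rewrite row_mul row0 xh //.
  by rewrite -row_mul Vx row0.
have [w pw] : exists w, p *m h = a *: w.
  apply: (weakly_regular_pair_mx (b := b) (D := q *m h) ab).
  apply/subr0_eq; rewrite !scalemxAl -mulmxBl xh // mulmxBl -!scalemxAl px qx.
  by rewrite !scale_scalar_mx mulrC subrr.
exists w; apply: (lreg_scalemx_inj ab.1).
rewrite scalemxAr -pw mulmxA -mul_scalar_mx; apply/subr0_eq.
by rewrite -mulmxBl xhM // mulmxBl -mulmxA px mul_scalar_mx mul_mx_scalar subrr.
Qed.

End RegularPair.

(** * A converse of the Hilbert-Burch theorem *)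

Section HilbertBurch.
Context (R : comNzRingType) (n : nat) (B : 'M[R]_(n, 1 + n)).
Context (x : 'cV[R]_(1 + n)) (a b : R) (p q : 'rV[R]_(1 + n)).
Hypotheses (ab : weakly_regular_pair a b).
Hypotheses (px : p *m x = a%:M) (qx : q *m x = b%:M).
Hypothesis Bx : B *m x = 0.

(** The square matrix [col_mx v B] kills [x], so its determinant kills the
    entries of [x], among whose combinations is a nonzerodivisor. *)
Lemma syzygy_signed_minors (v : 'rV_(1 + n)) :
  v *m x = 0 -> \det (col_mx v B) = 0.
Proof.
move=> vx; pose C := col_mx v B; have Cx : C *m x = 0.
  by rewrite mul_col_mx vx Bx col_mx0.
suff /(regular_col_cancel ab px) : x *m (\det C)%:M = 0 :> 'cV_(1 + n).
  by move=> /(congr1 (fun M : 'M_1 => M 0 0)); rewrite !mxE.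
by rewrite mul_mx_scalar -mul_scalar_mx -mul_adj_mx -mulmxA Cx mulmx0.
Qed.

(** Sending the generators [x] to the signed minors respects the relations, so
    it is a homomorphism from the ideal to the ring. *)
Lemma signed_minors_multiple : exists l, signed_minors B = l *: x.
Proof.
have [|w ->] := hom_ideal_mulmx ab px qx (h := signed_minors B).
  by move=> v vx; rewrite mul_signed_minors syzygy_signed_minors // raddf0.
by exists (w 0 0); rewrite {1}[w]mx11_scalar mul_mx_scalar.
Qed.

Context (l l' : R).
Hypotheses (Dx : signed_minors B = l *: x) (ll' : l' * l = 1).

Lemma hilbert_burch_inj (u : 'rV_n) : u *m B = 0 -> u = 0.
Proof.
move=> /signed_minors_kermx; rewrite Dx -scalemxAl => /(congr1 ( *:%R l')).
by rewrite scalerA ll' scale1r scaler0 => /(regular_col_cancel ab px).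
Qed.

(** Cramer's rule expresses each x_i v as W_i B.  As [B] is injective, the rows
    W_i respect the relations of the x_i, so they are x_i w for one row [w], and
    then x_i (v - w B) = 0 for all i. *)
Lemma hilbert_burch_exact (v : 'rV_(1 + n)) :
  v *m x = 0 -> exists w, v = w *m B.
Proof.
move=> vx; have [W] := signed_minors_mul (syzygy_signed_minors vx).
rewrite Dx -scalemxAl => /(congr1 ( *:%R l')).
rewrite scalerA ll' scale1r scalemxAl; move: (l' *: W) => {}W xv.
have [|w Ww] := hom_ideal_mulmx ab px qx (h := W).
  move=> u ux; apply: hilbert_burch_inj.
  by rewrite -mulmxA -xv mulmxA ux mul0mx.
exists w; apply/subr0_eq; apply: (regular_col_cancel ab px).
by rewrite mulmxBr xv Ww mulmxA subrr.
Qed.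

End HilbertBurch.

(** * Nakayama's lemma and the choice of a unit *)

Lemma pi_ideal_eq0 (R : comNzRingType) (I : idealr R) (c : R) :
  (\pi_({ideal_quot I}) c = 0) <-> c \in I.
Proof.
rewrite -[c in c \in I]subr0 Quotient.idealrBE.
rewrite -(rmorph0 (\pi_({ideal_quot I}))).
by split=> /eqP.
Qed.

Section LocalRing.
Context (R : comNzRingType).

Lemma idealr_closed_idealr (S : {pred R}) :
  idealr_closed S -> exists K : idealr R, K =i S.
Proof.
move=> cS; pose M := isIdealr.Build R S cS.
by pose K : idealr R := HB.pack S M; exists K.
Qed.

(** Zorn's lemma on the proper ideals that contain [J]; the empty chain is
    bounded by [J], any other by its union. *)
Lemma maximal_ideal_above (J : idealr R) :
  exists2 m : idealr R, maximal_ideal m & {subset J <= m}.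
Proof.
pose T := {K : idealr R | {subset J <= K}}.
pose le (K L : T) := `[< {subset sval K <= sval L} >].
pose J0 : T := exist _ J (fun _ => id).
have [|K2 K1 K3 /asboolP h1 /asboolP h2|A totA|[m Jm] maxm] :=
    @ZL_preorder T J0 le.
- by move=> K; apply/asboolP.
- by apply/asboolP=> z /h1/h2.
- have [[K0 AK0]|A0] := pselect (exists K, A K); last first.
    by exists J0 => K AK; case: A0; exists K.
  pose S : {pred R} := fun z => `[< exists2 K : T, A K & z \in sval K >].
  have SE z : (z \in S) = `[< exists2 K : T, A K & z \in sval K >] by [].
  have [|U UE] := @idealr_closed_idealr S.
    split; rewrite ?SE; first by apply/asboolP; exists K0; last exact: rpred0.
      by apply/asboolP=> -[K _]; rewrite idealr1.
    move=> c u v; rewrite !SE => /asboolP[K AK uK] /asboolP[L AL vL]; apply/asboolP.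
    have [/asboolP KL|/asboolP LK] := totA K L AK AL.
      by exists L => //; apply: rpredD => //; apply/idealMr/KL.
    by exists K => //; apply: rpredD (LK _ vL); apply: idealMr.
  have JU : {subset J <= U}.
    by move=> z zJ; rewrite UE SE; apply/asboolP; exists K0 => //; apply: (svalP K0).
  exists (exist _ U JU) => K AK; apply/asboolP=> z zK /=.
  by rewrite UE SE; apply/asboolP; exists K.
exists m => // K mK z.
have JK : {subset J <= K} by move=> y /Jm/mK.
have /asboolP Km : le (exist _ K JK) (exist _ m Jm) by apply: maxm; apply/asboolP.
by apply/idP/idP => [/Km|/mK].
Qed.

Lemma local_ring_unit (m : idealr R) (l : R) :
    (forall m' : idealr R, maximal_ideal m' -> m' =i m) -> l \notin m ->
  exists l', l' * l = 1.
Proof.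
move=> mmax lm; apply: contrapT => lN1.
pose S : {pred R} := fun z => `[< exists c, z = c * l >].
have SE z : (z \in S) = `[< exists c, z = c * l >] by [].
have [|K KE] := @idealr_closed_idealr S.
  split; rewrite ?SE; first by apply/asboolP; exists 0; rewrite mul0r.
    by apply/asboolP=> -[c E]; apply: lN1; exists c.
  move=> c y z; rewrite !SE => /asboolP[u ->] /asboolP[v ->]; apply/asboolP.
  by exists (c * u + v); rewrite mulrDl mulrA.
have [m' m'max Km'] := maximal_ideal_above K.
move/negP: lm; apply; rewrite -(mmax m' m'max); apply: Km'.
by rewrite KE SE; apply/asboolP; exists 1; rewrite mul1r.
Qed.

(** The determinant of [1 - N] kills [x] by the adjugate formula, and it is 1
    modulo [m] because [N] vanishes there. *)
Lemma determinant_trick n (m : idealr R) (N : 'M[R]_n) (x : 'cV[R]_n) :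
    (forall i j, N i j \in m) -> x = N *m x ->
  exists2 d, d - 1 \in m & d *: x = 0.
Proof.
move=> Nm xN; exists (\det (1%:M - N)); last first.
  rewrite -mul_scalar_mx -mul_adj_mx -mulmxA mulmxBl mul1mx -xN subrr.
  by rewrite mulmx0.
have NE : map_mx \pi_({ideal_quot m}) (1%:M - N) = 1%:M.
  apply/matrixP=> i j; rewrite !mxE rmorphB /=.
  rewrite ((pi_ideal_eq0 m (N i j)).2 (Nm i j)) subr0.
  by rewrite rmorph_nat.
rewrite Quotient.idealrBE; apply/eqP; transitivity (1 : {ideal_quot m}).
  by rewrite -det_map_mx NE det1.
by rewrite rmorph1.
Qed.

End LocalRing.

Section UnitMinors.
Context (R : comNzRingType) (k n : nat) (A : 'M[R]_(k, 1 + n)).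
Context (x : 'cV[R]_(1 + n)) (a b : R) (p q : 'rV[R]_(1 + n)).
Hypotheses (ab : weakly_regular_pair a b).
Hypotheses (px : p *m x = a%:M) (qx : q *m x = b%:M).
Hypothesis Ax : A *m x = 0.

(** If no multiplier l were a unit, all would lie in the maximal ideal, every
    minor of [A] would be a combination of the entries of [x] with coefficients
    in that ideal, and the determinant trick would give an element congruent to
    1 that kills the nonzerodivisor [a]. *)
Lemma signed_minors_unit_multiple : local_ring R ->
    (forall i, ideal_gen (minors n A) (x i 0)) ->
  exists f l l', signed_minors (rowsub f A) = l *: x /\ l' * l = 1.
Proof.
move=> [m _ mmax] xA; apply: contrapT => noUnit.
have fx (f : 'I_n -> 'I_k) : rowsub f A *m x = 0 by rewrite mul_rowsub_mx Ax raddf0.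
have lm f : exists2 l, l \in m & signed_minors (rowsub f A) = l *: x.
  have [l lE] := signed_minors_multiple ab px qx (fx f); exists l => //.
  apply: contrapT => /negP/(local_ring_unit mmax)[l' l'l].
  by apply: noUnit; exists f, l, l'.
have mx y : ideal_gen (minors n A) y ->
    exists u : 'rV_(1 + n), (forall i, u 0 i \in m) /\ u *m x = y%:M.
  move=> [c [cA ->]]; elim: c cA => [|[e d] c IHc] cA.
    by exists 0; rewrite big_nil mul0mx raddf0; split=> // i; rewrite mxE rpred0.
  have [i ic|u [um ux]] := IHc; first by apply: cA; rewrite in_cons ic orbT.
  have [f [g [_ _ /= dE]]] := cA (e, d) (mem_head _ _).
  have [j [r dj]] := det_colsub_signed_minors (rowsub f A) g.
  have [l lI fl] := lm f.
  have {}dE : d = r * (l * x j 0).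
    transitivity (\det (colsub g (rowsub f A))); last by rewrite dj fl mxE.
    by rewrite dE; congr (\det _); apply/matrixP=> i i'; rewrite !mxE.
  exists ((e * r * l) *: delta_mx 0 j + u); split=> [i|].
    by rewrite !mxE rpredD // mulrC idealMr // idealMr.
  rewrite mulmxDl ux -scalemxAl -rowE big_cons raddfD /= dE; congr (_ + _).
  by rewrite [row j x]mx11_scalar mxE scale_scalar_mx !mulrA.
have N i : {u : 'rV_(1 + n) | (forall j, u 0 j \in m) /\ u *m x = (x i 0)%:M}.
  exact/cid/mx.
have [i j||d dm dx] := @determinant_trick _ _ m (\matrix_i sval (N i)) x.
- by rewrite mxE; case: (N i) => u [].
- apply/row_matrixP=> i; rewrite row_mul rowK.
  by case: (N i) => u [_ /= ->]; rewrite [row i x]mx11_scalar mxE.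
have d0 : d = 0.
  apply: ab.1; rewrite mulr0; move/(congr1 (mulmx p)): dx.
  rewrite -scalemxAr px mulmx0 scale_scalar_mx mulrC.
  by move=> /(congr1 (fun M : 'M_1 => M 0 0)); rewrite !mxE.
by move: dm; rewrite d0 sub0r rpredN idealr1.
Qed.

End UnitMinors.

(** * Regular sequences and the bound grade I <= 2 *)

Section GradeTwo.
Context (R : comNzRingType).

Lemma ideal_gen_nil (y : R) : ideal_gen [set` [::]] y -> y = 0.
Proof.
move=> [c [c0 ->]]; rewrite big_seq big1 // => z /c0.
by rewrite /= in_nil.
Qed.

Lemma ideal_gen_cons (a : R) s y :
  ideal_gen [set` a :: s] y <->
  exists c z, ideal_gen [set` s] z /\ y = c * a + z.
Proof.
split=> [[c [cs ->]]|[c [_ [[d [ds ->] ->]]]]]; last first.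
  exists ((c, a) :: d); split=> [z|]; last by rewrite big_cons.
  rewrite /= !in_cons => /orP[/eqP-> /=|/ds /= ->]; first by rewrite eqxx.
  by rewrite orbT.
elim: c cs => [|[e d] c IHc] cs.
  exists 0, 0; rewrite big_nil mul0r addr0; split=> //.
  by exists [::]; rewrite big_nil.
have [z zc|u [_ [[v [vs ->]] cE]]] := IHc.
  by apply: cs; rewrite in_cons zc orbT.
have := cs (e, d) (mem_head _ _); rewrite big_cons cE /= in_cons.
case/orP=> [/eqP-> |ds].
  exists (e + u), (\sum_(p <- v) p.1 * p.2).
  by split; [exists v | rewrite mulrDl addrA].
exists u, (\sum_(p <- (e, d) :: v) p.1 * p.2); rewrite big_cons addrCA; split=> //.
exists ((e, d) :: v); rewrite big_cons; split=> // z; rewrite in_cons.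
by case/orP=> [/eqP->|/vs].
Qed.

Lemma ideal_gen1 (a y : R) : ideal_gen [set` [:: a]] y <-> exists c, y = c * a.
Proof.
split=> [/ideal_gen_cons[c [z [/ideal_gen_nil-> ->]]]|[c ->]].
  by exists c; rewrite addr0.
apply/ideal_gen_cons; exists c, 0; rewrite addr0; split=> //.
by exists [::]; rewrite big_nil.
Qed.

Lemma ideal_gen2 (a b y : R) :
  ideal_gen [set` [:: a; b]] y <-> exists c d, y = c * a + d * b.
Proof.
split=> [/ideal_gen_cons[c [z [/ideal_gen1[d ->] ->]]]|[c [d ->]]].
  by exists c, d.
by apply/ideal_gen_cons; exists c, (d * b); split=> //; apply/ideal_gen1; exists d.
Qed.

Lemma regular_seq_catl (s t : seq R) : regular_seq (s ++ t) -> regular_seq s.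
Proof.
move=> [reg st1]; split=> [i i_s c|[c [cs c1]]].
  have i_st : (i < size (s ++ t))%N by rewrite size_cat ltn_addr.
  by have := reg i i_st c; rewrite nth_cat i_s takel_cat // ltnW.
apply: st1; exists c; split=> // z /cs /=.
by rewrite mem_cat => ->.
Qed.

Lemma regular_seq_weakly_regular_pair (a b : R) :
  regular_seq [:: a; b] -> weakly_regular_pair a b.
Proof.
move=> [reg _]; split.
  apply: mulrI0_lreg => c ac0; apply/ideal_gen_nil/(reg 0) => //=.
  by exists [::]; rewrite big_nil.
move=> c d bc.
suff /ideal_gen1[e ->] : ideal_gen [set` [:: a]] c by exists e; rewrite mulrC.
by apply: (reg 1) => //=; apply/ideal_gen1; exists d; rewrite bc mulrC.
Qed.

Context (n k : nat) (B : 'M[R]_(k, n)) (x : 'cV[R]_n).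
Context (a b : R) (p q : 'rV[R]_n).
Hypotheses (ab : weakly_regular_pair a b).
Hypotheses (px : p *m x = a%:M) (qx : q *m x = b%:M).
Hypothesis Bx : B *m x = 0.
Hypothesis Binj : forall u : 'rV_k, u *m B = 0 -> u = 0.
Hypothesis Bexact : forall v : 'rV_n, v *m x = 0 -> exists w, v = w *m B.

(** With I the ideal of the entries of [x], the row [w] below lifts the
    comparison map from the Koszul complex of [a, b] to the resolution of R/I,
    and its class modulo (a, b) describes the inclusion of
    Ext^2(R/I, R) = Hom(R/I, R/(a, b)) into R/(a, b).  Its entries are killed by
    I modulo (a, b), hence they vanish there if [c] in I is regular modulo
    (a, b).  Correcting [p] and [q] by multiples of rows of [B] then makes
    b p = a q, so that p = a t and a = p x = a (t x). *)
Lemma regular_triple_unit c r :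
    r *m x = c%:M -> regular_seq [:: a; b; c] -> exists t : 'rV_n, t *m x = 1%:M.
Proof.
move=> rx [reg _].
have BexactM m (V : 'M_(m, n)) : V *m x = 0 -> exists W, V = W *m B.
  move=> Vx; have w i : {w | row i V = w *m B}.
    by apply/cid/Bexact; rewrite -row_mul Vx row0.
  exists (\matrix_i sval (w i)); apply/row_matrixP=> i.
  by rewrite row_mul rowK; case: (w i).
have BinjM m (U V : 'M_(m, k)) : U *m B = V *m B -> U = V.
  move=> UV; apply/subr0_eq/row_matrixP=> i; rewrite row0; apply: Binj.
  by rewrite -row_mul mulmxBl UV subrr row0.
have [|w wE] := Bexact (v := b *: p - a *: q).
  by rewrite mulmxBl -!scalemxAl px qx !scale_scalar_mx mulrC subrr.
(* Both x_j p and a e_j express a x_j in the generators [x], so they differ by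
   a relation; likewise for x_j q and b e_j. *)
have [|S SE] := BexactM _ (x *m p - a%:M).
  by rewrite mulmxBl -mulmxA px mul_mx_scalar mul_scalar_mx subrr.
have [|T TE] := BexactM _ (x *m q - b%:M).
  by rewrite mulmxBl -mulmxA qx mul_mx_scalar mul_scalar_mx subrr.
have xw : x *m w = b *: S - a *: T.
  apply: BinjM; rewrite -mulmxA -wE mulmxBr -!scalemxAr mulmxBl -!scalemxAl.
  rewrite -SE -TE !scalerBr !scale_scalar_mx opprB addrA [a * b]mulrC subrK.
  by [].
(* Multiplying by [r] turns x w in (a, b) into c w in (a, b). *)
have wab j : {e : R * R | w 0 j = e.1 * a + e.2 * b}.
  apply/cid; suff /ideal_gen2[c1 [c2 ->]] : ideal_gen [set` [:: a; b]] (w 0 j).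
    by exists (c1, c2).
  apply: (reg 2) => //=.
  apply/ideal_gen2; exists (- (r *m T) 0 j), ((r *m S) 0 j).
  have /(congr1 (fun M : 'rV_k => M 0 j)) : c *: w = b *: (r *m S) - a *: (r *m T).
    by rewrite -mul_scalar_mx -rx -mulmxA xw mulmxBr -!scalemxAr.
  by rewrite !mxE => ->; rewrite mulNr addrC [in RHS]mulrC [_ * b]mulrC addrC.
pose al := \row_j (sval (wab j)).1; pose be := \row_j (sval (wab j)).2.
have wE2 : w = a *: al + b *: be.
  apply/rowP=> j; rewrite !mxE; case: (wab j) => e /= ->.
  by rewrite mulrC [b * _]mulrC.
have [|t tE] := weakly_regular_pair_mx (C := p - be *m B) (D := q + al *m B) ab.
  have bp : b *: p = a *: q + w *m B by rewrite -wE addrC subrK.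
  by rewrite scalerBr scalerDr bp wE2 mulmxDl -!scalemxAl addrA addrK.
exists t; apply: (lreg_scalemx_inj ab.1).
rewrite scalemxAl -tE mulmxBl px -mulmxA Bx mulmx0 subr0.
by rewrite scale_scalar_mx mulr1.
Qed.

End GradeTwo.

(** * Projective dimension of R/I *)

Section ProjectiveDimension.
Context (R : comNzRingType).

Section FreeModule.
Context (M : lmodType R) (n : nat) (e : 'I_n -> M).

Definition lincomb (v : 'rV[R]_n) : M := \sum_i v 0 i *: e i.

Fact lincomb_is_linear : linear lincomb.
Proof.
move=> c u v; rewrite /lincomb scaler_sumr -big_split; apply: eq_bigr => i _.
by rewrite !mxE scalerDl scalerA.
Qed.

HB.instance Definition _ :=
  GRing.isLinear.Build R 'rV[R]_n M *:%R lincomb lincomb_is_linear.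

End FreeModule.

Lemma linear_lincomb (M : lmodType R) n (g : {linear 'rV[R]_n -> M}) v :
  g v = lincomb (fun i => g (delta_mx 0 i)) v.
Proof.
rewrite {1}[v]row_sum_delta linear_sum; apply: eq_bigr => i _.
by rewrite linearZ.
Qed.

Lemma projective_free n : projective_module 'rV[R]_n.
Proof.
move=> M N f g fsurj.
have m i : {y | f y = g (delta_mx 0 i)} by apply/cid/fsurj.
exists (lincomb (fun i => sval (m i))) => v.
rewrite [g v]linear_lincomb linear_sum; apply: eq_bigr => i _.
by rewrite linearZ; case: (m i) => y /= ->.
Qed.

Context (I : idealr R).

(** The domain is R seen as the free module of rows of length 1, so that all
    terms of the resolution have the same form. *)
Definition quot_map (v : 'rV[R]_1) : {ideal_quot I} := \pi_({ideal_quot I}) (v 0 0).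

Fact quot_map_is_linear : linear quot_map.
Proof. by move=> c u v; rewrite /quot_map !mxE rmorphD rmorphM. Qed.

HB.instance Definition _ :=
  GRing.isLinear.Build R 'rV[R]_1 {ideal_quot I} *:%R quot_map quot_map_is_linear.

Lemma quot_map_surj y : exists v, quot_map v = y.
Proof. by exists (const_mx (repr y)); rewrite /quot_map mxE reprK. Qed.

Section Corestriction.
Context (P : lmodType R) (g : {linear P -> 'rV[R]_1}).
Hypothesis gI : forall y, g y 0 0 \in I.

Definition corestriction (y : P) : ideal_module I := Sub (g y 0 0) (gI y).

Fact corestriction_is_linear : linear corestriction.
Proof. by move=> c u v; apply/val_inj; rewrite /= linearP !mxE. Qed.

HB.instance Definition _ :=
  GRing.isLinear.Build R P (ideal_module I) *:%R corestriction corestriction_is_linear.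

End Corestriction.

Lemma proj_dim_le_quot2 n (B : 'M[R]_(n, 1 + n)) (x : 'cV[R]_(1 + n)) :
    (forall y, y \in I <-> exists v : 'rV_(1 + n), v *m x = y%:M) ->
    B *m x = 0 ->
    (forall u : 'rV_n, u *m B = 0 -> u = 0) ->
    (forall v : 'rV_(1 + n), v *m x = 0 -> exists w, v = w *m B) ->
  proj_dim_le {ideal_quot I} 2.
Proof.
move=> xI Bx Binj Bexact.
pose rk i := match i with 0 => 1 | 1 => 1 + n | 2 => n | _ => 0 end%N.
pose D i : 'M[R]_(rk i.+1, rk i) :=
  match i return 'M[R]_(rk i.+1, rk i) with 0 => x | 1 => B | _ => 0 end.
exists (fun i => 'rV[R]_(rk i)), (fun i => mulmxr (D i)), quot_map; split.
- by move=> i; apply: projective_free.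
- by case=> [|[|[|i]]] // _ v; apply: thinmx0.
- exact: quot_map_surj.
- move=> v; rewrite /quot_map; split=> [/pi_ideal_eq0/xI[u ux]|[u <-]].
    by exists u; rewrite /= ux -mx11_scalar.
  by apply/pi_ideal_eq0/xI; exists u; rewrite -mx11_scalar.
- move=> [|[|i]] v /=; split=> [v0|[w <-]]; rewrite -?mulmxA ?Bx ?mulmx0 ?mul0mx //.
  + by have [w ->] := Bexact v v0; exists w.
  + by exists 0; rewrite (Binj v v0) mul0mx.
  + by rewrite mulmx0.
  + by exists 0; rewrite mul0mx [v]thinmx0.
Qed.

(** Lift 1 to [u] in P_0, and lift P_0 -> R/I to [g : P_0 -> R], so that g(u) is 1
    modulo I.  For y in I the element y u comes from a unique element of P_1, and
    projectivity of P_1 lifts its image under P_1 -> I to R^n.  This gives a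
    homomorphism from I to R^n that is a section of [f] up to the factor g(u).
    It is multiplication by a row [w], whence g(u) = w x lies in I, and so
    does 1. *)
Lemma not_proj_dim_le_quot1 n (f : {linear 'rV[R]_n -> ideal_module I})
    (x : 'cV[R]_n) (a b : R) (p q : 'rV[R]_n) :
    (forall y, exists v, f v = y) -> (forall v, (val (f v))%:M = v *m x) ->
    weakly_regular_pair a b -> p *m x = a%:M -> q *m x = b%:M ->
  ~ proj_dim_le {ideal_quot I} 1.
Proof.
move=> fsurj fx ab px qx [P [d [e [Pproj P0 esurj e0 d0]]]].
have dinj y : d 0%N y = 0 -> y = 0.
  by move=> /d0[z <-]; rewrite (P0 2 isT z) raddf0.
have [u u1] := esurj 1.
have [g ge] := Pproj 0%N _ _ quot_map e quot_map_surj.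
have gu : g u 0 0 - 1 \in I.
  by rewrite -pi_ideal_eq0 rmorphB rmorph1 -u1 -ge subrr.
have gdI y : (g \o d 0%N) y 0 0 \in I.
  by rewrite -pi_ideal_eq0 -[LHS]/(quot_map _) ge; apply/e0; exists y.
have [h fh] := Pproj 1%N _ _ f (corestriction gdI) fsurj.
have xI i : x i 0 \in I.
  have := fx (delta_mx 0 i); rewrite -rowE => /(congr1 (fun M : 'M_1 => M 0 0)).
  by rewrite !mxE /= => <-; apply: valP.
have z i : {z | d 0%N z = x i 0 *: u}.
  apply/cid/e0; rewrite linearZ u1 -[LHS]/(\pi_({ideal_quot I}) (x i 0) * 1).
  by rewrite mulr1 pi_ideal_eq0.
pose H := \matrix_i h (sval (z i)).
have [|w Hw] := hom_ideal_mulmx ab px qx (h := H).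
  move=> v vx.
  have -> : v *m H = h (lincomb (fun i => sval (z i)) v).
    rewrite linear_sum mulmx_sum_row; apply: eq_bigr => i _.
    by rewrite linearZ rowK.
  rewrite [lincomb _ _]dinj ?raddf0 // linear_sum.
  transitivity ((v *m x) 0 0 *: u); last by rewrite vx mxE scale0r.
  rewrite mxE scaler_suml; apply: eq_bigr => i _.
  by rewrite linearZ -scalerA; case: (z i) => y /= ->.
have Hx : H *m x = (g u 0 0) *: x.
  apply/row_matrixP=> i; rewrite row_mul rowK -fx fh /= linearZ.
  case: (z i) => y /= ->; rewrite linearZ [row i x]mx11_scalar !mxE.
  by rewrite scale_scalar_mx mulrC.
have guE : (w *m x) 0 0 = g u 0 0.
  suff : w *m x - (g u 0 0)%:M = 0.
    by move=> /(congr1 (fun M : 'M_1 => M 0 0)); rewrite !mxE => /subr0_eq.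
  apply: (regular_col_cancel ab px).
  by rewrite mulmxBr mulmxA -Hw Hx mul_mx_scalar subrr.
have wI : g u 0 0 \in I.
  rewrite -guE -fx mxE mulr1n; exact: valP.
by have := rpredB wI gu; rewrite opprB addrC subrK idealr1.
Qed.

Lemma proj_dim_le_mono (M : lmodType R) i j :
  (i <= j)%N -> proj_dim_le M i -> proj_dim_le M j.
Proof.
move=> ij [P [d [e [Pp P0 eS e0 d0]]]]; exists P, d, e; split=> // k jk.
exact/P0/(leq_ltn_trans ij).
Qed.

End ProjectiveDimension.

(** * Perfection of I *)

Theorem theorem3p1 (R : comNzRingType) (I : idealr R)
    (hnoeth : noetherian R) (hlocal : local_ring R)
    (hgrade : exists2 n : nat, (2 <= n)%N & has_grade I n)
    (hfitt : is_Fitting_ideal 1 (ideal_module I) [set` I]%classic) :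
  perfect_of_grade2 I.
Proof.
have [N N2 [s [sreg sI _] sz]] := hgrade.
case: s sz sreg sI => [|a [|b s]] sz; try by rewrite -sz in N2.
rewrite -[a :: b :: s]/([:: a; b] ++ s) => /regular_seq_catl regab sI {N N2 sz}.
have ab := regular_seq_weakly_regular_pair regab.
have aI : a \in I by apply: sI; rewrite mem_head.
have bI : b \in I by apply: sI; rewrite !inE eqxx orbT.
have [m [r [A [[f fsurj fA] fittI]]]] := hfitt.
case: r => [|n] in A f fsurj fA fittI *.
  (* An ideal without generators is zero, but it contains a nonzerodivisor. *)
  have [v fv] := fsurj (Sub a aI); move/(congr1 val): fv.
  rewrite SubK (thinmx0 v) raddf0 /= => a0.
  by have /ab.1/eqP : a * 1 = a * 0; [rewrite -a0 !mul0r | rewrite oner_eq0].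
rewrite subn1 /= in fittI.
pose x : 'cV[R]_(1 + n) := \col_i val (f (delta_mx 0 i)).
have fx v : (val (f v))%:M = v *m x.
  rewrite (linear_lincomb f) raddf_sum raddf_sum.
  rewrite [v in RHS]row_sum_delta mulmx_suml; apply: eq_bigr => i _.
  by rewrite -scalemxAl -rowE [row i x]mx11_scalar !mxE scale_scalar_mx.
have xI y : y \in I <-> exists v, v *m x = y%:M.
  split=> [yI|[v vx]].
    by have [v fv] := fsurj (Sub y yI); exists v; rewrite -fx fv SubK.
  move: (congr1 (fun M : 'M_1 => M 0 0) (fx v)); rewrite vx !mxE !mulr1n => <-.
  exact: valP.
have [p px] := (xI a).1 aI; have [q qx] := (xI b).1 bI.
have Ax : A *m x = 0.
  apply/row_matrixP=> i; rewrite row_mul row0 -fx.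
  have -> : f (row i A) = 0 by apply/fA; exists (delta_mx 0 i); rewrite rowE.
  by rewrite raddf0.
have [i|g [l [l' [Dx l'l]]]] := signed_minors_unit_multiple ab px qx Ax hlocal.
  rewrite -fittI /=; apply/xI; exists (delta_mx 0 i).
  by rewrite -rowE [row i x]mx11_scalar mxE.
pose B := rowsub g A.
have Bx : B *m x = 0 by rewrite mul_rowsub_mx Ax raddf0.
have Binj := hilbert_burch_inj ab px Dx l'l.
have Bexact := hilbert_burch_exact ab px qx Bx Dx l'l.
split; last first.
  split; first exact: proj_dim_le_quot2 xI Bx Binj Bexact.
  move=> k; rewrite ltnS => k1 /(proj_dim_le_mono k1).
  exact: not_proj_dim_le_quot1 fsurj fx ab px qx.
exists [:: a; b] => //; split=> // [z|c cI /= regabc].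
  by rewrite !inE => /orP[/eqP->|/eqP->].
have [t tc] := (xI c).1 cI.
have /xI := regular_triple_unit ab px qx Bx Binj Bexact tc regabc.
by rewrite idealr1.
Qed.
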